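(* A connective space $(E,\mathcal{K})$ is diffeologisable if and only if it is integral and it admits a system of generators $\mathcal{G}\subset\mathcal{K}$ all of whose members $G\in\mathcal{G}$ satisfy $\mathrm{card}(G)\le\mathfrak{c}$. In particular, every integral connective space $(E,\mathcal{K})$ with $\mathrm{card}(E)\le\mathfrak{c}$ is diffeologisable.
   Context: $\mathfrak{c}$ is the cardinality of the continuum. A connective space $(E,\mathcal{K})$ is a set $E$ with a set $\mathcal{K}$ of subsets of $E$ (the connected subsets; $\mathcal{K}$ is a connective structure on $E$) such that $\emptyset\in\mathcal{K}$ and the union of every nonempty family of members of $\mathcal{K}$ with nonempty intersection belongs to $\mathcal{K}$. It is integral if $\{x\}\in\mathcal{K}$ for all $x\in E$. $\mathcal{G}\subset\mathcal{K}$ is a system of generators of $\mathcal{K}$ if $\mathcal{K}=[\mathcal{G}]_0$, the smallest connective structure on $E$ containing $\mathcal{G}$. A parametrization of $E$ is a map $p:U_p\to E$ with $U_p$ open in some $\mathbf{R}^{n_p}$, $n_p\ge 0$. A diffeology $\mathcal{D}$ on $E$ is a set of parametrizations of $E$ (called plots) containing all constant parametrizations, such that a parametrization which is locally (in a neighbourhood of each point of its domain) in $\mathcal{D}$ is in $\mathcal{D}$, and such that $p\circ q\in\mathcal{D}$ for each $p\in\mathcal{D}$ and each $C^\infty$ map $q:V\to U_p$, $V$ open in some $\mathbf{R}^m$. A path in $(E,\mathcal{D})$ is a plot with domain $\mathbf{R}$. A subset $A\subset E$ is connected in $(E,\mathcal{D})$ if for all $a_0,a_1\in A$ there is a path $\sigma$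 with $\sigma(0)=a_0$, $\sigma(1)=a_1$ and $\sigma(\mathbf{R})\subset A$. The set of these subsets is an integral connective structure on $E$, denoted $U_{DC}(\mathcal{D})$. A connective space $(E,\mathcal{K})$ is diffeologisable if there is a diffeology $\mathcal{D}$ on $E$ with $U_{DC}(\mathcal{D})=\mathcal{K}$. *)

(* Defs.v *)
From HB Require Import structures.
From mathcomp Require Import all_boot all_order all_algebra.
From mathcomp Require Import all_classical all_reals all_analysis.
Set Implicit Arguments.
Unset Strict Implicit.
Unset Printing Implicit Defensive.
Import Order.TTheory GRing.Theory Num.Theory.
Import numFieldNormedType.Exports.
Local Open Scope classical_set_scope.
Local Open Scope card_scope.
Local Open Scope ring_scope.

(** * Connective spaces *)

Definition connective_structure (E : Type) (K : set (set E)) : Prop :=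
  K set0 /\
  (forall F : set (set E), F !=set0 -> F `<=` K ->
    \bigcap_(A in F) A !=set0 -> K (\bigcup_(A in F) A)).

Definition integral_structure (E : Type) (K : set (set E)) : Prop :=
  forall x : E, K [set x].

(* [smallest C G] is the intersection of all the M satisfying C that contain
   G; connective structures being stable under intersection, it is the
   structure [G]_0. *)
Definition generated_structure (E : Type) (G : set (set E)) : set (set E) :=
  smallest (@connective_structure E) G.

Definition generators (E : Type) (K G : set (set E)) : Prop :=
  G `<=` K /\ K = generated_structure G.

(** * Smooth maps between open subsets of the spaces R^n *)

(* Meaningful for V open: being C^k on V then depends only on the values of f
   on V, since ['D_v f x] depends only on the germ of f at x. *)
Fixpoint Ck_on (R : realType) (m n : nat) (k : nat) (V : set 'rV[R]_m)
    (f : 'rV[R]_m -> 'rV[R]_n) : Prop :=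
  match k with
  | 0%N => forall x, V x -> {for x, continuous f}
  | k'.+1 => (forall x, V x -> differentiable f x) /\
             (forall v : 'rV[R]_m, Ck_on k' V (fun x => 'D_v f x))
  end.

Definition smooth_on (R : realType) (m n : nat) (V : set 'rV[R]_m)
    (f : 'rV[R]_m -> 'rV[R]_n) : Prop :=
  forall k : nat, Ck_on k V f.

(* The extension f of q only serves to use the derivatives of the library,
   which are defined for functions on the whole of R^m; its values outside V
   are irrelevant. *)
Definition smooth_map (R : realType) (m n : nat) (V : set 'rV[R]_m)
    (U : set 'rV[R]_n) (q : V -> U) : Prop :=
  exists f : 'rV[R]_m -> 'rV[R]_n,
    smooth_on V f /\ forall x : V, f (val x) = val (q x).

(** * Diffeologies *)

Record parametrization (R : realType) (E : Type) := Parametrization {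
  pdim : nat;
  pdom : set 'rV[R]_pdim;
  pdom_open : open pdom;
  pmap :> pdom -> E
}.
Arguments pdom {R E} p _.
Arguments pmap {R E} p _.

Definition const_param (R : realType) (E : Type) (n : nat)
    (U : set 'rV[R]_n) (oU : open U) (e : E) : parametrization R E :=
  Parametrization oU (fun=> e).

Definition restrict_param (R : realType) (E : Type) (p : parametrization R E)
    (W : set 'rV[R]_(pdim p)) (oW : open W) (sW : W `<=` pdom p) :
    parametrization R E :=
  Parametrization oW (fun x : W => p (subfun sW x)).

Definition comp_param (R : realType) (E : Type) (p : parametrization R E)
    (m : nat) (V : set 'rV[R]_m) (oV : open V) (q : V -> pdom p) :
    parametrization R E :=
  Parametrization oV (fun x : V => p (q x)).

Definition locally_in (R : realType) (E : Type)
    (D : set (parametrization R E)) (p : parametrization R E) : Prop :=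
  forall x, pdom p x ->
    exists (W : set 'rV[R]_(pdim p)) (oW : open W) (sW : W `<=` pdom p),
      W x /\ D (restrict_param oW sW).

Definition diffeology (R : realType) (E : Type)
    (D : set (parametrization R E)) : Prop :=
  [/\ forall (n : nat) (U : set 'rV[R]_n) (oU : open U) (e : E),
        D (const_param oU e),
      forall p : parametrization R E, locally_in D p -> D p
    & forall (p : parametrization R E) (m : nat) (V : set 'rV[R]_m)
        (oV : open V) (q : V -> pdom p),
        D p -> smooth_map q -> D (comp_param oV q) ].

(* A map from R, seen as a parametrization with domain the whole of R^1. *)
Definition line_param (R : realType) (E : Type) (sigma : R -> E) :
    parametrization R E :=
  Parametrization (@openT 'rV[R]_1)
    (fun x : [set: 'rV[R]_1] => sigma (val x ord0 ord0)).

Definition path_in (R : realType) (E : Type) (D : set (parametrization R E))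
    (sigma : R -> E) : Prop :=
  D (line_param sigma).

Definition U_DC (R : realType) (E : Type) (D : set (parametrization R E)) :
    set (set E) :=
  [set A | forall a0 a1 : E, A a0 -> A a1 ->
    exists sigma : R -> E,
      [/\ path_in D sigma, sigma 0 = a0, sigma 1 = a1 & range sigma `<=` A]].

Definition diffeologisable (R : realType) (E : Type) (K : set (set E)) : Prop :=
  exists D : set (parametrization R E), diffeology D /\ U_DC D = K.

(* card(A) <= the cardinality of the continuum, i.e. of the set of reals. *)
Definition card_le_continuum (R : realType) (E : Type) (A : set E) : Prop :=
  A #<= [set: R].

(* Main.v *)
Require Import Defs.
From HB Require Import structures.
From mathcomp Require Import all_boot all_order all_algebra.
From mathcomp Require Import all_classical all_reals all_analysis.
From mathcomp Require Import lra zify.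
Local Open Scope classical_set_scope.

(** If [K = U_DC D], then the range of each path of [D] is connected, because a
    path between two of its points is obtained by an affine change of
    parameter. A range has at most the cardinality of the reals, and a nonempty
    connected set is the union of the ranges of the paths issued from one of
    its points and contained in it, so the members of [K] of cardinality at
    most that of the continuum generate [K] ([generators_small_U_DC]).

    Conversely, let [K] be integral and generated by [G], whose members are no
    larger than the continuum. The diffeology [darboux_diffeology K] consists
    of the parametrizations whose composite with each continuous arc of their
    domain has an image in [K]. It satisfies the locality axiom because a
    segment is exhausted by finitely many small segments, with images in [K]
    that overlap ([segment_chain]). Its paths are the maps [sigma] that send
    each segment to a member of [K] ([path_darboux]), so that
    [U_DC (darboux_diffeology K)] is contained in [K]. These paths can be
    concatenated without any smoothing, so [U_DC (darboux_diffeology K)] is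
    itself a connective structure, and it remains to see that it contains [G].
    A nonempty [A] in [G] is the target of a map from the line that takes every
    value in [A] on each nondegenerate segment ([strongly_darboux]). The image
    of a segment under this map is either [A] or a singleton, so the map is a
    path, and after an affine change of parameter it joins any two given points
    of [A].

    The map of [strongly_darboux] first sends a real to the set of natural
    numbers coded by the tail of its expansion in base 4, which is onto the
    subsets of [nat] on each nondegenerate segment; the reals, hence [A], embed
    in the subsets of [nat] by Dedekind cuts. *)

Set Implicit Arguments.
Unset Strict Implicit.
Unset Printing Implicit Defensive.

(** * Maps that are onto on each nondegenerate segment *)

Section Digits.
Import Order.TTheory GRing.Theory Num.Theory numFieldNormedType.Exports.
Local Open Scope ring_scope.
Context {R : realType}.
Implicit Types (a b x : R) (d : nat -> bool).

(** Whether the [n]-th digit of [x] after the point is 1 in base 4. *)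
Definition digit x (n : nat) : bool :=
  (Num.floor (4 ^+ n * x) %% 4)%Z == 1.

Lemma cauchy_cut (u v : nat -> R) : (forall i j, u i <= v j) ->
  exists x, forall n, u n <= x <= v n.
Proof.
move=> uv; exists (sup (range u)) => n; apply/andP; split.
  by apply: ub_le_sup; [exists (v 0%N) => _ [i _ <-]|exists n].
by apply: ge_sup; [exists (u 0%N), 0%N|move=> _ [i _ <-]].
Qed.

(** All the digits of index larger than [N] can be prescribed, as 0 or 1, for
    some [x] in the segment from [m0 / 4 ^ N] to [(m0 + 1) / 4 ^ N]. *)
Lemma digit_prescribed (m0 : int) (N : nat) d :
  exists x, m0%:~R <= 4 ^+ N * x <= (m0 + 1)%:~R /\
            forall n, (N < n)%N -> digit x n = d n.
Proof.
pose m := fix m (k : nat) : int :=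
  if k is k'.+1 then m k' * 4 + (d (N + k)%N : nat)%:Z else m0.
(* As the digits 2 and 3 are not used, the tail of the expansion stays below
   one half, and the floor of [4 ^ (N + k) * x] is exactly [m k]. *)
pose u k : R := (m k)%:~R / 4 ^+ (N + k).
pose v k : R := ((m k)%:~R + 2^-1) / 4 ^+ (N + k).
have p4 k : 0 < 4 ^+ k :> R by rewrite exprn_gt0.
have uS k : u k <= u k.+1.
  rewrite /u addnS exprSr ler_pdivlMr ?mulr_gt0// mulrA divfK ?gt_eqF//=.
  rewrite intrD intrM lerDl; by case: (d _).
have vS k : v k.+1 <= v k.
  rewrite /v addnS exprSr ler_pdivrMr ?mulr_gt0// mulrA divfK ?gt_eqF//=.
  rewrite intrD intrM; case: (d _) => /=; rewrite ?(mulr1z, mulr0z); lra.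
have u_le i j : (i <= j)%N -> u i <= u j.
  move=> /subnKC <-; elim: (j - i)%N => [|k IH]; first by rewrite addn0.
  by rewrite addnS (le_trans IH).
have v_le i j : (i <= j)%N -> v j <= v i.
  move=> /subnKC <-; elim: (j - i)%N => [|k IH]; first by rewrite addn0.
  by rewrite addnS (le_trans _ IH).
have uv k : u k <= v k by rewrite /u /v ler_pM2r ?invr_gt0// lerDl.
have [x xP] : exists x, forall n, u n <= x <= v n.
  apply: cauchy_cut => i j.
  rewrite (le_trans (u_le i _ (leq_maxl i j)))// (le_trans (uv _))//.
  by rewrite v_le// leq_maxr.
have xm k : (m k)%:~R <= 4 ^+ (N + k) * x <= (m k)%:~R + 2^-1.
  by have := xP k; rewrite /u /v ler_pdivrMr// ler_pdivlMr// mulrC.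
exists x; split.
  have := xm 0%N; rewrite addn0 /= intrD => /andP[-> /le_trans->]//.
  by rewrite lerD2l; lra.
move=> n Nn; rewrite /digit.
have -> : n = (N + (n - N.+1).+1)%N by lia.
set k := (n - N.+1)%N.
have -> : Num.floor (4 ^+ (N + k.+1) * x) = m k.+1.
  apply/eqP; rewrite floor_eq; have /andP[-> /le_lt_trans->]// := xm k.+1.
  by rewrite intrD ltrD2l; lra.
by rewrite /= modzMDl; case: (d _).
Qed.

Lemma digit_dense a b d : a < b ->
  exists x, a <= x <= b /\ exists N, forall n, (N < n)%N -> digit x n = d n.
Proof.
move=> ab; pose N := Num.bound (2 / (b - a)).
have p4 : 0 < 4 ^+ N :> R by rewrite exprn_gt0.
have N2 : 2 <= 4 ^+ N * (b - a).
  rewrite -ler_pdivrMr ?subr_gt0// ltW//.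
  have := upper_nthrootP (leqnn N) => /lt_le_trans -> //.
  by rewrite lerXn2r ?nnegrE; lra.
have [x [/andP[mx xm] xd]] := digit_prescribed (Num.floor (4 ^+ N * a) + 1) N d.
have /andP[fa af] := floor_itv (4 ^+ N * a).
move: mx xm af; rewrite !intrD => mx xm af.
exists x; split; last by exists N.
rewrite -(ler_pM2l p4) -[x <= b](ler_pM2l p4).
move: (4 ^+ N) (Num.floor _)%:~R N2 mx xm af fa {xd p4} => c z.
by rewrite mulrBr => *; apply/andP; split; lra.
Qed.

(** The set of natural numbers coded by the tail of [x]: [k] belongs to it when
    infinitely many of the digits whose index has 2-adic valuation [k] are equal
    to 1. It is unchanged when finitely many digits of [x] are. *)
Definition digit_set x : set nat :=
  [set k | forall N, exists m, [/\ (N < m)%N, logn 2 m = k & digit x m]].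

Lemma digit_set_onto a b (S : set nat) : a < b ->
  exists x, a <= x <= b /\ digit_set x = S.
Proof.
move=> ab; have [x [xab [N xN]]] := digit_dense (fun n => logn 2 n \in S) ab.
exists x; split=> //; apply/seteqP; split=> k /=.
  by move=> /(_ N)[m [Nm <-]]; rewrite xN// => /set_mem.
move=> Sk M; exists (2 ^ k * (maxn M N).*2.+1)%N.
have gtM : (maxn M N < 2 ^ k * (maxn M N).*2.+1)%N.
  rewrite (@leq_trans (maxn M N).*2.+1)//; first by rewrite -addnn; lia.
  by rewrite leq_pmull// expn_gt0.
have lk : logn 2 (2 ^ k * (maxn M N).*2.+1)%N = k.
  rewrite lognM ?expn_gt0// lognX (_ : logn 2 2 = 1%N)// muln1.
  by rewrite lognE dvdn2 /= odd_double /= addn0.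
split=> //; first by lia.
by rewrite xN ?lk ?mem_set//; lia.
Qed.

(** The rationals below [x], encoded as natural numbers. *)
Definition cut x : set nat :=
  [set k | exists2 q : rat, unpickle k = Some q & ratr q < x].

Lemma cut_inj : injective cut.
Proof.
have lt_neq x y : x < y -> cut x <> cut y.
  move=> xy exy; have [q] := rat_in_itvoo xy; rewrite in_itv/= => /andP[xq qy].
  have : cut y (pickle q) by exists q => //; rewrite pickleK.
  rewrite -exy => -[q']; rewrite pickleK => -[<-] /lt_trans /(_ xq).
  by rewrite ltxx.
move=> x y exy; case: (ltgtP x y) => // [/lt_neq//|/lt_neq]; by rewrite exy.
Qed.

(** A nonempty set [A] no larger than the continuum is the target of a function
    that takes every value in [A] on each nondegenerate segment. *)
Lemma strongly_darboux {E : Type} (A : set E) : A !=set0 ->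
  card_le_continuum R A ->
  exists f : R -> E, (forall x, A (f x)) /\
    forall a b e, a < b -> A e -> exists x, a <= x <= b /\ f x = e.
Proof.
rewrite /card_le_continuum => -[e0 Ae0] /pcard_injP[i i_inj].
have /choice[f fP] (x : R) : exists y,
    A y /\ forall e, A e -> cut (i e) = digit_set x -> y = e.
  case: (pselect (exists2 e, A e & cut (i e) = digit_set x)).
    move=> [e Ae ex]; exists e; split=> // e' Ae'; rewrite -ex => /cut_inj.
    by move=> /i_inj ->//; rewrite inE.
  by move=> nex; exists e0; split=> // e Ae ex; exfalso; apply: nex; exists e.
exists f; split=> [x|a b e ab Ae]; first by have [] := fP x.
have [x [xab xe]] := digit_set_onto (cut (i e)) ab.
by exists x; split=> //; apply: (fP x).2.
Qed.
End Digits.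

(** * Affine changes of parameter *)

Section Affine.
Import Order.TTheory GRing.Theory Num.Theory numFieldNormedType.Exports.
Local Open Scope ring_scope.
Context {R : realType}.

Lemma smooth_cst m n (V : set 'rV[R]_m) (w : 'rV[R]_n) :
  smooth_on V (fun=> w).
Proof.
move=> k; elim: k w => [w x _|k IH w]; first exact: cst_continuous.
split=> [x _|v]; first exact: differentiable_cst.
rewrite (_ : (fun x => 'D_v _ x) = fun=> 0); first exact: IH.
by apply/funext => x; rewrite derive_cst.
Qed.

Lemma smooth_affine m (V : set 'rV[R]_m) (c : R) (w : 'rV[R]_m) :
  smooth_on V (fun x => c *: x + w).
Proof.
have df x : differentiable (fun x : 'rV[R]_m => c *: x + w) x.
  apply: differentiableD; last exact: differentiable_cst.
  exact: (@differentiableZ _ _ _ id).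
case=> [x _|k]; first exact: differentiable_continuous.
split=> [x _ //|v].
rewrite (_ : (fun x => 'D_v _ x) = fun=> c *: v); first exact: smooth_cst.
apply/funext => x.
rewrite (@deriveD _ _ _ (fun x : 'rV[R]_m => c *: x) (cst w)).
- by rewrite derive_cst addr0 (@deriveZ _ _ _ id) ?derive_id.
- exact: (derivableZ (@derivable_id _ _ _ _)).
- exact: derivable_cst.
Qed.

Lemma path_affine (E : Type) (D : set (parametrization R E)) (sigma : R -> E)
    (c s : R) :
  diffeology D -> path_in D sigma -> path_in D (fun t => sigma (c * t + s)).
Proof.
move=> [_ _ Dcomp] Dsigma.
pose f (x : 'rV[R]_1) : 'rV[R]_1 := c *: x + const_mx s.
pose q (x : [set: 'rV[R]_1]) : pdom (line_param sigma) :=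
  exist _ (f (val x)) (mem_set I).
have -> : path_in D (fun t => sigma (c * t + s)) = D (comp_param openT q).
  congr (D _); rewrite /line_param /comp_param; congr Parametrization.
  by apply/funext => x; rewrite /= !mxE.
by apply: Dcomp => //; exists f; split=> //; exact: smooth_affine.
Qed.

Lemma U_DC_range (E : Type) (D : set (parametrization R E)) (sigma : R -> E) :
  diffeology D -> path_in D sigma -> U_DC D (range sigma).
Proof.
move=> dD Dsigma _ _ [s _ <-] [t _ <-].
exists (fun u => sigma ((t - s) * u + s)); split.
- exact: path_affine.
- by rewrite mulr0 add0r.
- by rewrite mulr1 subrK.
- by move=> _ [u _ <-]; exists ((t - s) * u + s).
Qed.
End Affine.

(** * Connective structures *)

Section Connective.
Context {E : Type}.
Implicit Types (K G : set (set E)) (A B : set E).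

(** A set is connected as soon as one of its points is joined to each other
    one by a connected subset. *)
Lemma connective_star K A a :
  connective_structure K -> A a ->
  (forall b, A b -> exists B, [/\ K B, B a, B b & B `<=` A]) -> K A.
Proof.
move=> [_ KU] Aa AK.
rewrite (_ : A = \bigcup_(B in [set B | [/\ K B, B a & B `<=` A]]) B).
  apply: KU => [|B []//|]; last by exists a => B [].
  by have [B [KB Ba _ BA]] := AK a Aa; exists B.
apply/seteqP; split=> [b Ab|b [B [_ _ BA] Bb]]; last exact: BA.
by have [B [KB Ba Bb BA]] := AK b Ab; exists B.
Qed.

Lemma connective_setU K A B :
  connective_structure K -> K A -> K B -> A `&` B !=set0 -> K (A `|` B).
Proof.
move=> cK KA KB [a [Aa Ba]].
apply: (connective_star (a := a)) => // [|b [Ab|Bb]].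
- by left.
- by exists A; split=> // ?; left.
- by exists B; split=> // ?; right.
Qed.

Lemma connective_generated G : connective_structure (generated_structure G).
Proof.
split=> [K [[K0 _] _] //|F F0 FG aF K cK].
by apply: cK.1.2 => // B /FG; exact.
Qed.

Lemma generated_sub K G :
  connective_structure K -> G `<=` K -> generated_structure G `<=` K.
Proof. by move=> cK GK; apply: smallest_sub. Qed.
End Connective.

(** * Segments of the real line *)

Section Segments.
Import Order.TTheory GRing.Theory Num.Theory numFieldNormedType.Exports.
Local Open Scope ring_scope.
Context {R : realType}.

(** A relation between the ends of segments that can be concatenated, and that
    holds for the small segments near each point of [[a, b]], holds for
    [a, b]. *)
Lemma segment_chain (P : R -> R -> Prop) (a b : R) : a <= b ->
  (forall s t u, s <= t -> t <= u -> P s t -> P t u -> P s u) ->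
  (forall t, a <= t <= b -> exists2 e, 0 < e & forall s u,
     a <= s -> s <= u -> u <= b -> t - e < s -> u < t + e -> P s u) ->
  P a b.
Proof.
move=> ab Ptr Ploc; pose S := [set u | a <= u <= b /\ P a u].
have Sa : S a.
  split; first by rewrite lexx.
  have [|e e0] := Ploc a; first by rewrite lexx.
  by apply=> //; [rewrite gtrBl|rewrite ltrDl].
have Sb : ubound S b by move=> u [/andP[]].
have supS : has_sup S by split; [exists a|exists b].
have aS : a <= sup S by apply: ub_le_sup => //; exists b.
have Sle : sup S <= b by apply: ge_sup => //; exists a.
(* The supremum of the points reached from [a] is reached, and is [b]. *)
have [|e e0 Pe] := Ploc (sup S); first by rewrite aS.
have [u [/andP[au ub] Pau] eu] := sup_adherent e0 supS.
have uS : u <= sup S by apply: ub_le_sup; [exists b|split=> //; rewrite au].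
pose v := Num.min b (sup S + e / 2).
have Sv : sup S <= v by rewrite le_min Sle lerDl divr_ge0// ltW.
have uv : u <= v by exact: le_trans Sv.
have vb : v <= b by rewrite ge_min lexx.
have Pav : P a v.
  apply: (Ptr a u v) => //; apply: Pe => //.
  by rewrite gt_min ltrD2l ltr_pdivrMr// ltr_pMr// ltr1n orbT.
have : v <= sup S.
  by apply: ub_le_sup; [exists b|split=> //; rewrite (le_trans au uv)].
rewrite /v; case: (leP b (sup S + e / 2)) => [bS _|_].
  by move: Pav; rewrite /v (min_idPl bS).
by rewrite gerDl leNgt divr_gt0.
Qed.

Lemma continuous_segment_image (g : R -> R) (a b : R) : a <= b ->
  (forall t, a <= t <= b -> {for t, continuous g}) ->
  exists c d, c <= d /\ g @` [set t | a <= t <= b] = [set t | c <= t <= d].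
Proof.
move=> ab gc.
have gw s u : a <= s -> u <= b -> {within `[s, u], continuous g}.
  move=> as_ ub; apply: continuous_in_subspaceT => t.
  rewrite inE/= in_itv/= => /andP[st tu]; apply: gc.
  by rewrite (le_trans as_ st) (le_trans tu ub).
have [tc + gtc] := EVT_min ab (gw _ _ (lexx a) (lexx b)).
have [td + gtd] := EVT_max ab (gw _ _ (lexx a) (lexx b)).
rewrite !in_itv/= => /andP[atd tdb] /andP[atc tcb].
exists (g tc), (g td); split; first by apply: gtc; rewrite in_itv/= atd.
apply/seteqP; split=> [_ [t /= tab <-]|y /= /andP[cy yd]].
  by rewrite gtc ?gtd// in_itv.
have cd := le_trans cy yd.
have [le|/ltW le] := leP tc td.
  have [|t] := @IVT R g tc td y le (gw _ _ atc tdb).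
    by rewrite ge_min le_max cy yd orbT.
  rewrite in_itv/= => /andP[? ?] <-; exists t => //=.
  by rewrite (le_trans atc)// (le_trans _ tdb).
have [|t] := @IVT R g td tc y le (gw _ _ atd tcb).
  by rewrite ge_min le_max cy yd orbT.
rewrite in_itv/= => /andP[? ?] <-; exists t => //=.
by rewrite (le_trans atd)// (le_trans _ tcb).
Qed.
End Segments.

(** * The Darboux diffeology of a connective structure *)

Section DarbouxDiffeology.
Import Order.TTheory GRing.Theory Num.Theory numFieldNormedType.Exports.
Local Open Scope ring_scope.
Context {R : realType} {E : Type}.
Implicit Types (K : set (set E)) (p : parametrization R E) (sigma : R -> E).

(** The image of [[a, b]] under [p \o g]. The condition [val x = g t] selects
    the [t] such that [g t] lies in the domain of [p], so [g] need not take its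
    values there. *)
Definition path_image p (g : R -> 'rV[R]_(pdim p)) (a b : R) : set E :=
  [set e | exists x : pdom p,
     (exists2 t, a <= t <= b & val x = g t) /\ p x = e].

Arguments path_image p g a b : clear implicits.

(** The parametrizations whose composite with each continuous arc [[a, b]] of
    their domain has an image in [K]. Continuity of [g : R -> 'rV_n] is required
    at the points of [[a, b]], in the sense of the whole line, and nothing is
    required of [g] elsewhere. *)
Definition darboux_diffeology K : set (parametrization R E) :=
  [set p | forall (g : R -> 'rV[R]_(pdim p)) a b, a <= b ->
    (forall t, a <= t <= b -> {for t, continuous g} /\ pdom p (g t)) ->
    K (path_image p g a b)].

Lemma darboux_path_image K p (g : R -> 'rV[R]_(pdim p)) (a b : R) :
  darboux_diffeology K p -> a <= b ->
  (forall t, a <= t <= b -> {for t, continuous g} /\ pdom p (g t)) ->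
  K (path_image p g a b).
Proof. exact. Qed.

Lemma darboux_diffeologyP K : connective_structure K -> integral_structure K ->
  diffeology (darboux_diffeology K).
Proof.
move=> cK iK; split.
- move=> n U oU e g a b ab gU.
  rewrite (_ : path_image _ _ _ _ = [set e]); first exact: iK.
  apply/seteqP; split=> [_ [x [_ <-]] //|_ ->].
  have /gU[_ Ua] : a <= a <= b by rewrite lexx.
  by exists (exist _ (g a) (mem_set Ua)); split=> //; exists a; rewrite ?lexx.
- move=> p lp g a b ab gU.
  (* The bounds [a <= s] and [u <= b] are part of the relation because [g] is
     controlled on [[a, b]] only. *)
  apply: (segment_chain
    (P := fun s u => a <= s -> u <= b -> K (path_image p g s u))) => //.
    move=> s t u st tu Kst Ktu as_ ub.
    have at_ := le_trans as_ st; have tb := le_trans tu ub.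
    rewrite (_ : path_image p g s u =
                 path_image p g s t `|` path_image p g t u).
      apply: connective_setU; [by []|exact: Kst|exact: Ktu|].
      have /gU[_ Ut] : a <= t <= b by rewrite at_.
      exists (p (exist _ (g t) (mem_set Ut))); split;
        (eexists; split; last reflexivity); by exists t; rewrite ?st ?tu ?lexx.
    apply/seteqP; split=> e.
      move=> [x [[r /andP[sr ru] xr] pe]].
      by case: (leP r t) => rt; [left|right]; exists x; split=> //; exists r;
        rewrite ?sr ?ru ?rt ?(ltW rt).
    by move=> [] [x [[r /andP[sr ru] xr] pe]]; exists x; split=> //; exists r;
      rewrite ?sr ?ru ?(le_trans sr)// ?(le_trans st sr) ?(le_trans ru tu).
  move=> t tab; have [gt Ut] := gU t tab.
  have [W [oW [sW [Wt DW]]]] := lp _ Ut.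
  have /nbhs_ballP[e e0 eW] : nbhs t (g @^-1` W).
    by apply: gt; exact: open_nbhs_nbhs.
  exists e => // s u as_ su ub ts ut _ _.
  have gW r : s <= r <= u -> W (g r).
    move=> /andP[sr ru]; apply: eW; rewrite /ball/= ltr_distlC.
    by rewrite (lt_le_trans ts)// (le_lt_trans ru).
  rewrite (_ : path_image p g s u = path_image (restrict_param oW sW) g s u).
    apply: (darboux_path_image DW su) => r rsu; split; last exact: gW.
    move: rsu => /andP[sr ru].
    by have [] := gU r; rewrite ?(le_trans as_ sr) ?(le_trans ru ub).
  apply/seteqP; split=> f [x [[r rsu xr] pf]].
    exists (exist _ (g r) (mem_set (gW r rsu))); split; first by exists r.
    by rewrite -pf /=; congr (p _); apply: val_inj; rewrite /= xr.
  by exists (subfun sW x); split=> //; exists r.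
- move=> p m V oV q Dp [f [sf fq]] g a b ab gV.
  rewrite (_ : path_image _ _ _ _ = path_image p (f \o g) a b).
    apply: (darboux_path_image Dp ab) => t tab; have [gt Vt] := gV t tab; split.
      by apply: continuous_comp => //; exact: (sf 0%N).
    by rewrite /= -[g t]/(val (exist (fun x => x \in V) (g t) (mem_set Vt))) fq;
      exact/set_mem/valP.
  apply/seteqP; split=> e [x [[t tab xt] pe]].
    by exists (q x); split=> //; exists t => //=; rewrite -fq xt.
  have [_ Vt] := gV t tab; exists (exist _ (g t) (mem_set Vt)).
  split; first by exists t.
  by rewrite -pe /=; congr (p _); apply: val_inj; rewrite -fq xt.
Qed.

Lemma path_darboux K sigma : path_in (darboux_diffeology K) sigma <->
  forall a b, a <= b -> K (sigma @` [set t | a <= t <= b]).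
Proof.
split=> [Ds a b ab|Ks g a b ab gc].
  pose g (t : R) : 'rV[R]_1 := t *: const_mx 1.
  rewrite (_ : _ @` _ = path_image (line_param sigma) g a b).
    apply: (darboux_path_image Ds ab) => t _; split; last exact: I.
    by apply: cvgZr_tmp; exact: cvg_id.
  apply/seteqP; split=> [_ [t tab <-]|_ [x [[t tab xt] <-]]].
    exists (exist _ (g t) (mem_set I)); split; first by exists t.
    by rewrite /= !mxE mulr1.
  by exists t => //=; rewrite xt !mxE mulr1.
have [|c [d [cd gcd]]] := @continuous_segment_image R
    (fun t => g t ord0 ord0) a b ab.
  move=> t /gc[gt _].
  exact: (continuous_comp gt (@coord_continuous _ _ _ ord0 ord0 _)).
rewrite (_ : path_image _ _ _ _ = sigma @` [set t | c <= t <= d]).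
  exact: Ks.
rewrite -gcd; apply/seteqP; split=> [_ [x [[t tab xt] <-]]|].
  by exists (g t ord0 ord0); [exists t|rewrite /= xt].
move=> _ [_ [t tab <-] <-].
by exists (exist _ (g t) (mem_set I)); split=> //; exists t.
Qed.

(** The concatenation is parametrized at unit speed: the second path starts at
    time 1. *)
Lemma path_concat K sigma tau : connective_structure K ->
  path_in (darboux_diffeology K) sigma -> path_in (darboux_diffeology K) tau ->
  sigma 1 = tau 0 ->
  path_in (darboux_diffeology K)
    (fun t => if t <= 1 then sigma t else tau (t - 1)).
Proof.
move=> cK /path_darboux Ks /path_darboux Kt st.
pose rho t := if t <= 1 then sigma t else tau (t - 1).
apply/path_darboux => a b ab; rewrite -/rho.
have rhol s u : s <= u -> u <= 1 -> K (rho @` [set t | s <= t <= u]).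
  move=> su u1; have := Ks _ _ su; congr (K _).
  apply: eq_imagel => t /= /andP[_ tu].
  by rewrite /rho (le_trans tu u1).
have rhor s u : s <= u -> 1 <= s -> K (rho @` [set t | s <= t <= u]).
  move=> su s1; have := Kt (s - 1) (u - 1); rewrite lerD2r => /(_ su).
  congr (K _); apply/seteqP; split=> _ [t /= /andP[h1 h2] <-].
    exists (t + 1); first by rewrite -lerBlDr h1 -lerBrDr.
    rewrite /rho; case: ifPn; last by rewrite addrK.
    rewrite gerDr => t0; have -> : t = 0 by apply/eqP; rewrite eq_le t0; lra.
    by rewrite add0r.
  exists (t - 1); first by rewrite !lerD2r h1.
  rewrite /rho; case: ifPn => // t1; have -> : t = 1 by lra.
  by rewrite subrr st.
have [b1|/ltW b1] := leP b 1; first exact: rhol.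
have [a1|/ltW a1] := leP 1 a; first exact: rhor.
rewrite (_ : _ @` _ = (rho @` [set t | a <= t <= 1]) `|`
                      (rho @` [set t | 1 <= t <= b])).
  apply: connective_setU => //; [exact: rhol|exact: rhor|].
  by exists (rho 1); split; exists 1; rewrite //= lexx ?a1 ?b1.
rewrite -image_setU; congr (_ @` _); apply/seteqP; split=> t /=.
  move=> /andP[at_ tb].
  by case: (leP t 1) => [?|/ltW ?]; [left|right]; apply/andP.
by move=> []/andP[h1 h2]; apply/andP; split=> //; lra.
Qed.

Lemma connective_U_DC_darboux K : connective_structure K ->
  integral_structure K -> connective_structure (U_DC (darboux_diffeology K)).
Proof.
move=> cK iK; have dD := darboux_diffeologyP cK iK.
split=> [? ? []|F _ FD [x Fx] a0 a1 [A FA Aa0] [B FB Ba1]].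
have [sigma [Ds s0 s1 sA]] := FD _ FA _ _ Aa0 (Fx _ FA).
have [tau [Dt t0 t1 tB]] := FD _ FB _ _ (Fx _ FB) Ba1.
(* Doubling the speed brings the final time of the concatenation back to 1. *)
have Dr := path_affine 2 0 dD (path_concat cK Ds Dt (etrans s1 (esym t0))).
eexists; split; first exact: Dr.
- by rewrite /= mulr0 addr0 ler01 s0.
- rewrite /= mulr1 addr0 ifF; last by lra.
  by rewrite -t1; congr tau; lra.
- move=> _ [u _ <-]; case: ifP => _.
    by exists A => //; apply: sA; eexists.
  by exists B => //; apply: tB; eexists.
Qed.

Lemma U_DC_darboux_sub K : connective_structure K ->
  U_DC (darboux_diffeology K) `<=` K.
Proof.
move=> cK A DA; have [->|/set0P[a Aa]] := eqVneq A set0; first exact: cK.1.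
apply: (connective_star (a := a)) => // b Ab.
have [sigma [/path_darboux Ks s0 s1 sA]] := DA _ _ Aa Ab.
exists (sigma @` [set t | 0 <= t <= 1]); split.
- exact: Ks.
- by exists 0; rewrite //= lexx ler01.
- by exists 1; rewrite //= lexx ler01.
- by move=> _ [t _ <-]; apply: sA; exists t.
Qed.

(** This is where maps that are onto on each nondegenerate segment are used. *)
Lemma U_DC_darboux_small K A : connective_structure K ->
  integral_structure K -> K A -> card_le_continuum R A ->
  U_DC (darboux_diffeology K) A.
Proof.
move=> cK iK KA Ac a0 a1 A0 A1.
have [|f [Af fA]] := @strongly_darboux R E A _ Ac; first by exists a0.
have Df : path_in (darboux_diffeology K) f.
  apply/path_darboux => a b; rewrite le_eqVlt => /predU1P[<-|ab].
    rewrite (_ : _ @` _ = [set f a]); first exact: iK.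
    apply/seteqP; split=> [_ [t /= ta <-]|_ ->].
      by have -> : t = a by apply/eqP; rewrite eq_le andbC.
    by exists a; rewrite /= ?lexx.
  rewrite (_ : _ @` _ = A) //.
  apply/seteqP; split=> [_ [t _ <-] //|e Ae].
  by have [x [xab <-]] := fA _ _ _ ab Ae; exists x.
have [s [s01 fs]] := fA 0 1 a0 ltr01 A0.
have [t [t01 ft]] := fA 0 1 a1 ltr01 A1.
exists (fun u => f ((t - s) * u + s)); split.
- exact: path_affine (darboux_diffeologyP cK iK) Df.
- by rewrite mulr0 add0r.
- by rewrite mulr1 subrK.
- by move=> _ [u _ <-].
Qed.

Lemma U_DC_darboux_generated K (G : set (set E)) : connective_structure K ->
  integral_structure K -> generators K G ->
  (forall A, G A -> card_le_continuum R A) ->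
  U_DC (darboux_diffeology K) = K.
Proof.
move=> cK iK [GK KG] Gc; apply/seteqP; split; first exact: U_DC_darboux_sub.
rewrite [X in X `<=` _]KG; apply: generated_sub.
  exact: connective_U_DC_darboux.
by move=> A GA; apply: U_DC_darboux_small; [| |exact: GK|exact: Gc].
Qed.
End DarbouxDiffeology.

(** * Small generators of a diffeologisable structure *)

Section Diffeologisable.
Import Order.TTheory GRing.Theory Num.Theory.
Local Open Scope ring_scope.
Context {R : realType} {E : Type}.
Implicit Types (D : set (parametrization R E)) (K : set (set E)).

Lemma integral_U_DC D : diffeology D -> integral_structure (U_DC D).
Proof.
move=> [Dcst _ _] x _ _ -> ->; exists (fun=> x); split=> //.
  exact: (Dcst _ _ openT).
by move=> _ [t _ <-].
Qed.

Lemma generators_small_U_DC D : diffeology D ->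
  connective_structure (U_DC D) ->
  generators (U_DC D) [set A | U_DC D A /\ card_le_continuum R A].
Proof.
move=> dD cD; split=> [A []//|].
apply/seteqP; split; last by apply: generated_sub => // A [].
have cG := connective_generated [set A | U_DC D A /\ card_le_continuum R A].
move=> A DA; have [->|/set0P[a Aa]] := eqVneq A set0; first exact: cG.1.
apply: (connective_star (a := a)) => // b Ab.
have [sigma [Ds s0 s1 sA]] := DA _ _ Aa Ab.
exists (range sigma); split=> //; [|by exists 0|by exists 1].
apply: sub_gen_smallest; split; first exact: U_DC_range.
exact: card_image_le.
Qed.
End Diffeologisable.

Unset Implicit Arguments.
Set Strict Implicit.
Set Printing Implicit Defensive.

Theorem mainTheorem2 (R : realType) (E : Type) (K : set (set E))
    (HK : connective_structure K) :
  (diffeologisable R K <->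
     integral_structure K /\
     exists G : set (set E),
       generators K G /\ forall A : set E, G A -> card_le_continuum R A) /\
  (integral_structure K -> card_le_continuum R [set: E] -> diffeologisable R K).
Proof.
have small_diff G : integral_structure K -> generators K G ->
    (forall A, G A -> card_le_continuum R A) -> diffeologisable R K.
  move=> iK GK Gc; exists (darboux_diffeology K); split.
    exact: darboux_diffeologyP.
  exact: U_DC_darboux_generated GK Gc.
split; first split.
- move=> [D [dD DK]]; rewrite -DK in HK *; split; first exact: integral_U_DC.
  by eexists; split; [exact: generators_small_U_DC|move=> A []].
- by move=> [iK [G [GK Gc]]]; exact: (small_diff G).
- move=> iK Ec; apply: (small_diff K) => //.
    split=> //; apply/seteqP; split; last exact: generated_sub.
    exact: sub_gen_smallest.
  by move=> A _; apply: card_le_trans Ec; exact/subset_card_le.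
Qed.
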